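(* Let $\mathbf{c}=(c_1,\dots,c_n)$ be a tuple of positive integers and let $C=\sum_{j=1}^n c_j$. The number of $\mathbf{c}$-building functions of length $n$ associated with $\mathbf{c}$ is $(1+C)^{n-1}$.
   Context: $[n]=\{1,\dots,n\}$. $\mathbf{c}$-building functions: given $a=(a_1,\dots,a_n)\in\mathbb{Z}_{\ge0}^n$, run the following process. Start with $M_0=\emptyset$ and $W_0=[n]$. At step $t=1,\dots,n$, let $H_{t-1}=\sum_{j\in M_{t-1}}c_j$ and $E_t=\{i\in W_{t-1} : a_i\le H_{t-1}\}$. If $E_t=\emptyset$ (while $W_{t-1}\neq\emptyset$) the process stops in a deadlock; otherwise choose any $v\in E_t$ and set $M_t=M_{t-1}\cup\{v\}$, $W_t=W_{t-1}\setminus\{v\}$. (Whether the process deadlocks does not depend on the choices made.) The sequence $a$ is a $\mathbf{c}$-building function if the process terminates with $M_n=[n]$ and $W_n=\emptyset$. *)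

(* Defs.v *)
(* Sequences (a_1, ..., a_n) are functions on 'I_n = {0, ..., n-1}, so all
   indices are shifted by one. *)
From mathcomp Require Import all_boot.

Set Implicit Arguments.
Unset Strict Implicit.
Unset Printing Implicit Defensive.

Section Building.
Variables (n : nat) (c : 'I_n -> nat) (a : {ffun 'I_n -> nat}).

Definition height (M : {set 'I_n}) : nat := \sum_(j in M) c j.

Definition eligible (M W : {set 'I_n}) : {set 'I_n} :=
  [set i in W | a i <= height M].

(* The process is nondeterministic (any eligible element may be chosen):
   [process t M W] means that some sequence of t choices leads to
   M_t = M and W_t = W. *)
Inductive process : nat -> {set 'I_n} -> {set 'I_n} -> Prop :=
| process_start : process 0 set0 [set: 'I_n]
| process_step t M W v :
    process t M W -> v \in eligible M W -> process t.+1 (v |: M) (W :\ v).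

Definition deadlock (M W : {set 'I_n}) : Prop :=
  W <> set0 /\ eligible M W = set0.

(* Some run succeeds; by [building_functionP] this is the same as no run
   ever reaching a deadlock, so the choices do not matter. *)
Definition building_function : Prop := process n [set: 'I_n] set0.

Lemma process_inv t M W : process t M W -> W = ~: M /\ #|M| = t.
Proof.
elim=> [|{}t {}M {}W v _ [-> <-]]; first by rewrite setC0 cards0.
by rewrite !inE => /andP[vM _]; rewrite setCU setIC -setDE cardsU1 vM.
Qed.

Lemma process_eligible t M W (N : {set 'I_n}) :
  process t M W -> M \subset N \/ exists v, v \in eligible N (~: N).
Proof.
elim=> [|{}t {}M {}W v _ [MN|]]; [by left; apply: sub0set | | by right].
rewrite !inE => /andP[_ av]; have [vN|vN] := boolP (v \in N).
  by left; rewrite subUset sub1set vN.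
right; exists v; rewrite !inE vN (leq_trans av) //.
by rewrite /height [leqRHS](big_setID M) /= (setIidPr MN) leq_addr.
Qed.

Lemma building_functionP :
  building_function <-> forall t M W, process t M W -> ~ deadlock M W.
Proof.
split=> [bf t M W /process_inv[-> _] [W0 E0]|nodl].
  have [|[v]] := process_eligible M bf; last by rewrite E0 inE.
  by rewrite subTset => /eqP ME; apply: W0; rewrite ME setCT.
have run t : t <= n -> exists M W, process t M W.
  elim: t => [_|t IH tn]; first by do 2 eexists; apply: process_start.
  have [M [W pMW]] := IH (ltnW tn).
  have [E0|[v vE]] := set_0Vmem (eligible M W).
    case: (nodl _ _ _ pMW); split=> // W0.
    have [WM Mt] := process_inv pMW.
    by have := cardsC M; rewrite -WM W0 cards0 addn0 Mt card_ord => tE; rewrite tE ltnn in tn.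
  by do 2 eexists; apply: process_step pMW vE.
have [M [W pMW]] := run n (leqnn n).
have [WM Mn] := process_inv pMW.
have MT : M = [set: 'I_n].
  by apply/eqP; rewrite eqEcard subsetT cardsT card_ord Mn leqnn.
by rewrite /building_function -MT -(setCT 'I_n) -MT -WM.
Qed.

End Building.

(* Main.v *)
(* Since all c_j > 0, a is building iff the indices j with a_j < h have total
   weight at least h, for every h <= C. Read modulo C + 1, this is the
   hypothesis of a cycle lemma: put weight \sum_(j | b_j = x) c_j - 1 at each
   point x of the circle Z/(C + 1); the total is -1, so exactly one rotation has
   all its proper partial sums nonnegative. Hence among the
   (C + 1)^n functions from [n] to the circle, one in C + 1 is building. *)
Require Import Defs.
From mathcomp Require Import all_boot all_algebra zify.
From mathcomp Require Import classical_sets functions cardinality.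

(** Unless [N], the indices with [a j < h], is everything, the first [v] outside [N] picked by a
    complete run has [h <= a v <= height c N]. Conversely, a deadlock at [M] breaks the threshold
    [(height c M).+1], since every index with [a j <= height c M] is already in [M]. *)
Lemma building_function_thresholdP n (c : 'I_n -> nat) (a : {ffun 'I_n -> nat}) :
    (forall j, 0 < c j) ->
  building_function c a <->
  forall h, h <= \sum_j c j -> h <= \sum_(j | a j < h) c j.
Proof.
move=> c_gt0; split=> [bf h hC|thr].
  pose N := [set j | a j < h].
  have -> : \sum_(j | a j < h) c j = height c N.
    by apply: eq_bigl => j; rewrite inE.
  have [|[v]] := process_eligible N bf.
    rewrite finset.subTset => /eqP->; rewrite /height.
    by under eq_bigl do rewrite inE.
  by rewrite !inE -leqNgt => /andP[]; apply: leq_trans.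
apply/building_functionP => t M W /process_inv[-> _] [/eqP/set0Pn[v]].
rewrite inE => vM E0; suff: height c M < height c M by rewrite ltnn.
apply: leq_trans (thr _ _) _.
  rewrite [leqRHS](bigID (mem M)) /= -addn1 leq_add2l.
  by rewrite (bigD1 v) //= addn_gt0 c_gt0.
rewrite /height [leqRHS]big_mkcond [leqLHS]big_mkcond /=; apply: leq_sum => j _.
rewrite ltnS; have /setP/(_ j) := E0; rewrite !inE.
by case: (j \in M) => /= [_|->] //; case: ifP.
Qed.

Section CycleLemma.

(** [Q t] stands for the weight met in [t] steps around a circle of [m] points; by [Q_wrap],
    [Q t - t] drops by one per turn. *)
Variables (m : nat) (Q : nat -> nat).
Hypothesis Q_wrap : forall k, k < m -> (Q (k + m)).+1 = Q k + m.

Let good k := forall h, h < m -> Q k + h <= Q (k + h).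

(** If [k < k'] are both good, [Q t - t] is no lower at [k'] than at [k], and no lower at [k + m]
    than at [k'], against the drop by one. *)
Lemma cycle_lemma_uniq k k' : k < m -> k' < m -> good k -> good k' -> k = k'.
Proof.
wlog le_kk' : k k' / k <= k'.
  by move=> W; case: (leqP k k') => [|/ltnW] le; [|symmetry]; apply: W.
move=> km k'm gk gk'; apply/eqP; rewrite eqn_leq le_kk' leqNgt; apply/negP => lt.
have := gk (k' - k); have := gk' (k + m - k'); have := Q_wrap k km.
have -> : k + (k' - k) = k' by lia.
have -> : k' + (k + m - k') = k + m by lia.
lia.
Qed.

(* The good starting point is the first minimum of t |-> Q t - t over
   [0, m); scaling by m turns this into a single minimisation. *)
Lemma cycle_lemma_exists : 0 < m -> exists2 k, k < m & good k.
Proof.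
move=> m_gt0; pose F (t : nat) := (Q t + (m - t)) * m + t.
case: (arg_minnP (fun t : 'I_m => F t) (isT : xpredT (Ordinal m_gt0))) => k _ kmin.
have km := ltn_ord k.
have {}kmin t : t < m -> Q k + t <= Q t + k /\ (Q k + t = Q t + k -> k <= t).
  move=> tm; have := kmin (Ordinal tm) isT; rewrite /F /=; split; nia.
exists k => // h hm; have [lt|le] := ltnP (k + h) m.
  by have := kmin _ lt; lia.
(* Past a full turn: a point before the first minimum lies strictly above it, which pays for the
   drop by one. *)
have lt : k + h - m < k by lia.
have := kmin _ (ltn_trans lt km); have := Q_wrap _ (ltn_trans lt km).
rewrite subnK //; lia.
Qed.

End CycleLemma.

Section Circle.

Import GRing.Theory.
Local Open Scope ring_scope.

Variables (n : nat) (c : 'I_n -> nat).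
Let C := (\sum_j c j)%N.
Let circ := {ffun 'I_n -> 'I_C.+1}.

Definition circular_building (b : circ) : bool :=
  [forall h : 'I_C.+1, (h <= \sum_(j | (b j < h)%N) c j)%N].

Definition rotate (k : 'I_C.+1) (b : circ) : circ := [ffun j => b j - k].

Let Q (b : circ) (t : nat) : nat :=
  (\sum_(i < t) \sum_(j | b j == inZp i) c j)%N.

(** Rotation carries the [t] points from [k] on to 0, ..., [t - 1], all distinct within one turn. *)
Lemma weight_rotate (b : circ) (k : 'I_C.+1) t : (t <= C.+1)%N ->
  Q b (k + t) = (Q b k + \sum_(j | (rotate k b j < t)%N) c j)%N.
Proof.
elim: t => [_|t IH tC]; first by rewrite addn0 big_pred0 ?addn0.
rewrite addnS /Q big_ord_recr /= -/(Q b (k + t)) IH ?(ltnW tC) // -addnA.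
congr (_ + _)%N; rewrite [RHS](bigID (fun j => (rotate k b j < t)%N)) /=.
congr (_ + _)%N; apply: eq_bigl => j.
  by case: ltngtP => //; lia.
have -> : (b j == inZp (k + t)) = (rotate k b j == t :> nat).
  rewrite ffunE -[t in RHS](modn_small tC) -[(t %% _)%N]/(val (inZp t : 'I_C.+1)).
  rewrite val_eqE subr_eq addrC; congr (_ == _).
  by apply: val_inj; rewrite /= modnDmr.
lia.
Qed.

Lemma circular_building_rotateP (b : circ) (k : 'I_C.+1) :
  reflect (forall h, (h < C.+1)%N -> (Q b k + h <= Q b (k + h))%N)
          (circular_building (rotate k b)).
Proof.
apply: (iffP forallP) => [H h hC|H h].
  by rewrite (weight_rotate b k _ (ltnW hC)) leq_add2l (H (Ordinal hC)).
by have := H h (ltn_ord h); rewrite (weight_rotate b k _ (ltnW (ltn_ord h))) leq_add2l.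
Qed.

Lemma card_circular_building_rotate (b : circ) :
  #|[pred k | circular_building (rotate k b)]| = 1%N.
Proof.
have wrap k : (k < C.+1)%N -> (Q b (k + C.+1)).+1 = (Q b k + C.+1)%N.
  move=> kC; rewrite (weight_rotate b (Ordinal kC) C.+1) //=.
  under eq_bigl do rewrite ltn_ord.
  by rewrite addnS.
have [k kC kgood] := cycle_lemma_exists _ _ wrap isT.
rewrite -(card1 (Ordinal kC)); apply: eq_card => k'.
rewrite !inE; apply/circular_building_rotateP/eqP => [k'good|->//].
by apply: val_inj; apply: (cycle_lemma_uniq _ _ wrap _ _ (ltn_ord k') kC).
Qed.

(** Double counting of the pairs [(b, k)] with [rotate k b] circular building: each [b] has one such
    [k], and each [rotate k] is a bijection. *)
Lemma card_circular_building :
  (#|circular_building| * C.+1 = C.+1 ^ n)%N.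
Proof.
have rotK k : cancel (rotate k) (rotate (- k)).
  by move=> b; apply/ffunP => j; rewrite !ffunE opprK subrK.
transitivity (\sum_(b : circ) #|[pred k | circular_building (rotate k b)]|)%N.
  under eq_bigr do rewrite -sum1_card big_mkcond.
  rewrite exchange_big /= -[X in (_ * X)%N](card_ord C.+1) mulnC -sum_nat_const.
  apply: eq_bigr => k _; rewrite -big_mkcond -sum1_card.
  apply: reindex; apply: onW_bij; exists (rotate (- k)) => //.
  by rewrite -{2}[k]opprK.
under eq_bigr do rewrite card_circular_building_rotate.
by rewrite sum1_card card_ffun !card_ord.
Qed.

End Circle.

Theorem theorem18 (n : nat) (c : 'I_n -> nat) (hc : forall j : 'I_n, 0 < c j) :
  ([set a : {ffun 'I_n -> nat} | building_function c a]
     #= `I_((1 + \sum_(j < n) c j)%N ^ n.-1)%N)%classic%card.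
Proof.
set C := \sum_(j < n) c j.
have cardG : #|circular_building n c| = (1 + C) ^ n.-1.
  have := card_circular_building n c; rewrite -/C add1n.
  case: n c hc @C => [|n] c hc C; last first.
    by rewrite expnSr => /eqP; rewrite eqn_pmul2r // => /eqP.
  (* For [n = 0] the exponent [n.-1] is 0, and a product equal to 1 forces the count to be 1. *)
  by rewrite expn0 => /eqP; rewrite muln_eq1 => /andP[/eqP].
pose f (b : {ffun 'I_n -> 'I_C.+1}) : {ffun 'I_n -> nat} := [ffun j => val (b j)].
have f_inj : injective f.
  by move=> b b' /ffunP E; apply/ffunP => j; apply: val_inj; have := E j; rewrite !ffunE.
have thrE b h : \sum_(j | f b j < h) c j = \sum_(j | b j < h) c j.
  by apply: eq_bigl => j; rewrite ffunE.
have -> : [set a | building_function c a]%classic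
    = (f @` [set` circular_building n c])%classic.
  apply/seteqP; split=> [a /building_function_thresholdP-/(_ hc) thr|_ [b /forallP bG <-]].
    (* The threshold [C] requires the entries below [C] to carry all the weight, leaving none for an
       entry above [C]. *)
    have aC j : a j < C.+1.
      rewrite ltnS leqNgt; apply/negP => Ca.
      have := thr C (leqnn _); rewrite leqNgt => /negP; apply.
      rewrite {2}/C [ltnRHS](bigID (fun j => a j < C)) /= -addn1 leq_add2l.
      by rewrite (bigD1 j) /= ?addn_gt0 ?hc // -leqNgt ltnW.
    have aE : a = f [ffun j => Ordinal (aC j)].
      by apply/ffunP => j; rewrite !ffunE.
    exists [ffun j => Ordinal (aC j)] => //=.
    by apply/forallP => h; rewrite -thrE -aE thr // -ltnS ltn_ord.
  apply/building_function_thresholdP => // h hC.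
  by rewrite thrE (bG (Ordinal (hC : h < C.+1))).
apply: card_eq_trans (inj_card_eq (in2W f_inj)) _.
have -> : [set` circular_building n c]%classic
    = (@enum_val _ (circular_building n c) @` [set: _])%classic.
  apply/seteqP; split=> [b bG|_ [i _ <-]]; last exact: enum_valP.
  by exists (enum_rank_in bG b) => //; rewrite enum_rankK_in.
rewrite -cardG (card_eqr card_II).
exact: inj_card_eq (in2W enum_val_inj).
Qed.
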